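(* Let $\mathcal M$ be a minimal time-like surface of general type in $\mathbb R^n_1$, and let $t\in\mathbb D$ and $s\in\mathbb D$ be variables which give canonical coordinates in a (connected) neighborhood of a given point of $\mathcal M$. If $t$ and $s$ determine one and the same orientation on $\mathcal M$, then they are related by an equality of the type $t=\pm s+c$. If $t$ and $s$ determine opposite orientations on $\mathcal M$, then they are related by an equality of the type $t=\pm\bar s+c$. Here $c\in\mathbb D$ is a constant.
   Context: Double numbers: $\mathbb D=\{t=u+\mathrm j v:\ u,v\in\mathbb R\}$ with $\mathrm j^2=1$; $\bar t=u-\mathrm j v$, $|t|^2=t\bar t=u^2-v^2$; $\mathbb D_0=\{t\in\mathbb D:|t|^2=0\}$. Put $\frac{\partial}{\partial t}=\frac12\left(\frac{\partial}{\partial u}+\mathrm j\frac{\partial}{\partial v}\right)$, $\frac{\partial}{\partial\bar t}=\frac12\left(\frac{\partial}{\partial u}-\mathrm j\frac{\partial}{\partial v}\right)$. Space: $\mathbb R^n_1$ ($n\ge 3$) is $\mathbb R^n$ with $a\cdot b=-a_1b_1+a_2b_2+\dots+a_nb_n$, and $\mathbb D^n_1=\mathbb D^n$ carries the $\mathbb D$-bilinear extension of this product; $a^2=a\cdot a$. Surfaces: a time-like surface $\mathcal M=(\mathcal D,\mathrm x)$ in $\mathbb R^n_1$ is given by a smooth immersion $\mathrm x(u,v):\mathcal D\to\mathbb R^n_1$ of a domain $\mathcal D\subset\mathbb R^2\cong\mathbb D$ (via $t=u+\mathrm jv$) whose induced metric is indefinite. $E=\mathrm x_u^2$, $F=\mathrm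 x_u\cdot\mathrm x_v$, $G=\mathrm x_v^2$; coordinates $(u,v)$ are isothermal if $E=-G$, $F=0$; they are always ordered so that $E<0$. $T_p(\mathcal M)$ is the tangent space, $N_p(\mathcal M)$ its orthogonal complement in $\mathbb R^n_1$; $a^\bot$ is the orthogonal projection of $a\in\mathbb D^n_1$ to the $\mathbb D$-linear span of $N_p(\mathcal M)$. With $\nabla$ the canonical flat connection, $\sigma(X,Y)=(\nabla_XY)^\bot$ is the second fundamental form; $\mathrm H=\frac12(-\sigma(X_1,X_1)+\sigma(X_2,X_2))$ for an orthonormal tangent basis with $X_1^2=-1$, $X_2^2=1$; $\mathcal M$ is minimal if $\mathrm H=0$ everywhere. In isothermal coordinates put $\Phi(t)=2\frac{\partial\mathrm x}{\partial t}=\mathrm x_u+\mathrm j\,\mathrm x_v\in\mathbb D^n_1$, $\Phi'=\frac{\partial\Phi}{\partial t}$, and ${\Phi'^{\bot}}^2=\Phi'^\bot\cdot\Phi'^\bot\in\mathbb D$. A point $p$ of a minimal time-like surface is degenerate if ${\Phi'^{\bot}}^2(p)\in\mathbb D_0$ (this does not depend on the isothermal coordinates). A minimal time-like surface is of general type if it has no degenerate points. Isothermal coordinates with $E<0$ on a minimal time-like surface are canonical if ${\Phi'^{\bot}}^2=1$ identically. A variable $s=\tilde u+\mathrm j\tilde v$ gives coordinates $(\tilde u,\tilde v)$ on $\mathcal M$ through an invertible change $t=t(s)$, and the corresponding function is $\tilde\Phi(s)=2\frac{\partial\mathrm x}{\partial s}$. *)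

(* Defs.v *)
From mathcomp Require Import all_boot all_order all_algebra.
From mathcomp Require Import all_classical all_reals.
From mathcomp Require Import topology normedtype derive.
Import Order.TTheory GRing.Theory Num.Theory.
Import numFieldNormedType.Exports.

Set Implicit Arguments.
Unset Strict Implicit.
Unset Printing Implicit Defensive.

Local Open Scope classical_set_scope.
Local Open Scope ring_scope.

Section Smooth.
Context {R : realType} {V W : normedModType R}.

(* For open U: C^0 is continuity on U, and f is C^(k+1) when it is
   differentiable on U and all its directional derivatives are C^k. *)
Fixpoint is_C (k : nat) (U : set V) (f : V -> W) : Prop :=
  match k with
  | 0%N => forall p, U p -> {for p, continuous f}
  | k'.+1 => (forall p, U p -> differentiable f p) /\
             (forall w, is_C k' U ('D_w f))
  end.

Definition smooth (U : set V) (f : V -> W) : Prop := forall k, is_C k U f.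

End Smooth.

(* (u, v) stands for u + j v.  Sum, opposite, scaling by reals and topology
   are those of R * R; the library's product and unit on R * R are
   componentwise and hence not those of the double numbers. *)
Definition dnum (R : realType) : Type := (R * R)%type.

Section DoubleNumbers.
Variable R : realType.

Definition dnum1 : dnum R := (1, 0).

Definition dmul (s t : dnum R) : dnum R :=
  (s.1 * t.1 + s.2 * t.2, s.1 * t.2 + s.2 * t.1).

Definition dconj (t : dnum R) : dnum R := (t.1, - t.2).

Definition dabs2 (t : dnum R) : dnum R := dmul t (dconj t).

Definition D0 : set (dnum R) := [set t | dabs2 t = 0].

Definition partial_u {W : normedModType R} (f : dnum R -> W) : dnum R -> W :=
  'D_((1, 0) : dnum R) f.

Definition partial_v {W : normedModType R} (f : dnum R -> W) : dnum R -> W :=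
  'D_((0, 1) : dnum R) f.

(* Jacobian determinant d(f1, f2) / d(u, v). *)
Definition jacobian_det (f : dnum R -> dnum R) (t : dnum R) : R :=
  (partial_u f t).1 * (partial_v f t).2 - (partial_v f t).1 * (partial_u f t).2.

End DoubleNumbers.

Arguments dnum1 {R}.

Section MinkowskiSpace.
Variables (R : realType) (n : nat).

(* The timelike direction is the coordinate of index 0. *)
Definition mdot (a b : 'rV[R]_n) : R :=
  \sum_(i < n) (if i == 0%N :> nat then - (a 0 i * b 0 i) else a 0 i * b 0 i).

(* (a, b) stands for a + j b. *)
Definition dvec : Type := ('rV[R]_n * 'rV[R]_n)%type.

Definition dvec_of (a : 'rV[R]_n) : dvec := (a, 0).

Definition mulj (a : dvec) : dvec := (a.2, a.1).

(* Double-bilinear extension of [mdot]. *)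
Definition ddot (a b : dvec) : dnum R :=
  (mdot a.1 b.1 + mdot a.2 b.2, mdot a.1 b.2 + mdot a.2 b.1).

Definition partial_t (f : dnum R -> dvec) (t : dnum R) : dvec :=
  2^-1 *: (partial_u f t + mulj (partial_v f t)).

End MinkowskiSpace.

Section Surfaces.
Variables (R : realType) (n : nat).
Implicit Types (x : dnum R -> 'rV[R]_n) (p : dnum R).

Definition surface_tangent x p : set 'rV[R]_n := range ('d x p).

Definition surface_normal x p : set 'rV[R]_n :=
  [set b | forall a, surface_tangent x p a -> mdot a b = 0].

(* As the normal space N is a real linear space, its span over the double
   numbers is N + j N. *)
Definition normal_dspan x p : set (dvec R n) :=
  [set b | surface_normal x p b.1 /\ surface_normal x p b.2].

(* Orthogonal projection to [normal_dspan x p]; it exists and is unique as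
   soon as the induced metric at p is nondegenerate. *)
Definition normal_part x p (a : dvec R n) : dvec R n :=
  xget 0 [set b | normal_dspan x p b /\
                  forall c, normal_dspan x p c -> ddot (a - b) c = 0].

Definition coefE x p : R := mdot (partial_u x p) (partial_u x p).
Definition coefF x p : R := mdot (partial_u x p) (partial_v x p).
Definition coefG x p : R := mdot (partial_v x p) (partial_v x p).

Definition timelike_surface (D : set (dnum R)) x : Prop :=
  [/\ open D, connected D & D !=set0] /\
  [/\ smooth D x,
      (forall p, D p -> injective ('d x p)) &
      (forall p, D p -> exists X Y,
         [/\ surface_tangent x p X, surface_tangent x p Y,
             mdot X X < 0 & 0 < mdot Y Y])].

(* sigma(X, Y) for X = dx(xi) and Y = dx(eta): the tangent vector Y at p is
   extended to the tangent field q |-> dx_q(eta), whose flat derivative along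
   X is then its derivative in the direction xi of the parameter plane. *)
Definition second_form x p (xi eta : dnum R) : dvec R n :=
  normal_part x p (dvec_of ('D_xi (fun q => 'd x q eta) p)).

Definition orthonormal_frame x p (xi1 xi2 : dnum R) : Prop :=
  [/\ mdot ('d x p xi1) ('d x p xi1) = -1,
      mdot ('d x p xi2) ('d x p xi2) = 1 &
      mdot ('d x p xi1) ('d x p xi2) = 0].

Definition mean_curvature x p (xi1 xi2 : dnum R) : dvec R n :=
  2^-1 *: (- second_form x p xi1 xi1 + second_form x p xi2 xi2).

Definition minimal_surface (D : set (dnum R)) x : Prop :=
  forall p, D p -> forall xi1 xi2, orthonormal_frame x p xi1 xi2 ->
    mean_curvature x p xi1 xi2 = 0.

(* [tau] maps the open part U of the surface diffeomorphically onto the open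
   set tau @` U, with inverse [phi]; the surface is then given on U, in the
   variable tau, by the immersion x \o phi on tau @` U. *)
Definition coordinates (D U : set (dnum R)) (tau phi : dnum R -> dnum R)
  : Prop :=
  [/\ open U, U `<=` D & open (tau @` U)] /\
  [/\ (forall p, U p -> phi (tau p) = p), smooth U tau & smooth (tau @` U) phi].

Definition isothermal (D : set (dnum R)) x (U : set (dnum R))
    (tau phi : dnum R -> dnum R) : Prop :=
  coordinates D U tau phi /\
  forall q, (tau @` U) q ->
    [/\ coefE (x \o phi) q = - coefG (x \o phi) q,
        coefF (x \o phi) q = 0 & coefE (x \o phi) q < 0].

(* Phi = 2 dx/dt = x_u + j x_v *)
Definition Phi x : dnum R -> dvec R n :=
  fun q => 2 *: partial_t (fun q' => dvec_of (x q')) q.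

(* (Phi'^bot)^2 *)
Definition dPhi_perp2 x (q : dnum R) : dnum R :=
  ddot (normal_part x q (partial_t (Phi x) q))
       (normal_part x q (partial_t (Phi x) q)).

Definition degenerate_point (D : set (dnum R)) x p : Prop :=
  exists (U : set (dnum R)) (tau phi : dnum R -> dnum R),
    [/\ U p, isothermal D x U tau phi &
        D0 (dPhi_perp2 (x \o phi) (tau p))].

Definition general_type (D : set (dnum R)) x : Prop :=
  forall p, D p -> ~ degenerate_point D x p.

Definition canonical_coordinates (D : set (dnum R)) x (U : set (dnum R))
    (tau phi : dnum R -> dnum R) : Prop :=
  isothermal D x U tau phi /\
  forall q, (tau @` U) q -> dPhi_perp2 (x \o phi) q = dnum1.

End Surfaces.

(* Orientations of two coordinate variables t, s on U, compared through the
   Jacobian of the change t = t(s); phis is the inverse of s. *)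
Definition same_orientation (R : realType) (U : set (dnum R))
    (t s phis : dnum R -> dnum R) : Prop :=
  forall q, (s @` U) q -> 0 < jacobian_det (t \o phis) q.

Definition opposite_orientation (R : realType) (U : set (dnum R))
    (t s phis : dnum R -> dnum R) : Prop :=
  forall q, (s @` U) q -> jacobian_det (t \o phis) q < 0.

(* Main.v *)
From HB Require Import structures.
Require Import Defs.
From mathcomp Require Import all_boot all_order all_algebra.
From mathcomp Require Import all_classical all_reals.
From mathcomp Require Import topology normedtype landau derive.
From mathcomp Require Import ring lra.
Import Order.TTheory GRing.Theory Num.Theory.
Import numFieldNormedType.Exports.

Set Implicit Arguments.
Unset Strict Implicit.
Unset Printing Implicit Defensive.

Local Open Scope classical_set_scope.
Local Open Scope ring_scope.

(* Let T be the change of variable from s to t, with partial derivatives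
   T_u = (a, c) and T_v = (b, d).  That both variables are isothermal with
   E < 0 forces a^2 - c^2 > 0 and (b, d) = e (c, a), where e = 1 or e = -1 is
   the sign of the Jacobian: T is holomorphic or antiholomorphic over the double
   numbers.  The second derivatives of T only contribute tangent vectors to
   Phi', so, up to a conjugation when e = -1, (Phi'^bot)^2 gets multiplied by
   (a + j c)^4.  For canonical variables (a + j c)^4 = 1, which together with
   a^2 > c^2 leaves c = 0 and a = 1 or a = -1; the sign is locally constant,
   hence constant on the connected domain, and T is affine. *)

(** * Differential calculus in normed spaces: germs, products, compositions, projections *)

(** The little-o expansion at [p] depends only on the germ, so the expansion of [f] also serves [g],
    with the same differential. *)
Lemma near_eq_differentiable (R : realType) (V W : normedModType R)
    (f g : V -> W) (p : V) :
  (\forall q \near p, f q = g q) -> differentiable f p -> differentiable g p.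
Proof.
move=> fg df; have fgp : f p = g p := nbhs_singleton fg.
have dE : g \o shift p = cst (g p) + 'd f p +o_ 0 id.
  apply/eqaddoP => e e0; have /eqaddoP/(_ e e0) := diff_locally df.
  have fg0 : \forall h \near (0 : V), f (h + p) = g (h + p).
    by move: fg; rewrite (near_shift 0); apply: filterS => h; rewrite /= subr0.
  by apply: filterS2 fg0 => h /= fgh; rewrite !fctE /= /shift/= fgh fgp.
have dfg : 'd g p = 'd f p :> (V -> W).
  by apply: diff_unique dE; exact: diff_continuous.
by apply/diff_locallyP; rewrite dfg; split => //; exact: diff_continuous.
Qed.

Section Scale.
Context (R : realType) (V W : normedModType R).

(** Scaling is a continuous bilinear map; once [sc] is packed as such, the product rule is the chain
    rule for its composition with the pair of [k] and [f]. *)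
Lemma is_diff_scale (k : V -> R) (f : V -> W) (p : V) :
  differentiable k p -> differentiable f p ->
  is_diff p (fun q => k q *: f q)
            (fun v => k p *: 'd f p v + 'd k p v *: f p).
Proof.
pose sc : R -> W -> W := fun a b => a *: b.
have scb : bilinear_for
    (GRing.Scale.Law.clone _ _ *:%R _) (GRing.Scale.Law.clone _ _ *:%R _) sc.
  split=> [u|u] a x y; rewrite /sc /=.
    by rewrite scalerDl scalerA.
  by rewrite scalerDr !scalerA mulrC.
pose scM := bilinear_isBilinear.Build R R W W _ _ sc scb.
pose scB : {bilinear R -> W -> W} := HB.pack sc scM.
have scc : continuous (fun q : R * W => scB q.1 q.2).
  by move=> q; exact: scale_continuous.
move=> dk df; set h := fun q => _.
have -> : h = (fun q : R * W => scB q.1 q.2) \o (fun q => (k q, f q)) by [].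
have dp := differentiable_pair dk df.
have db := @differentiable_bilin _ _ _ _ scB (k p, f p) scc.
apply: DiffDef; first exact: differentiable_comp.
by rewrite diff_comp // diff_pair // diff_bilin.
Qed.

End Scale.

Section Derive.
Context (R : realType) (U V W : normedModType R).

Lemma derive_scale (k : V -> R) (f : V -> W) (w p : V) :
  differentiable k p -> differentiable f p ->
  'D_w (fun q => k q *: f q) p = k p *: 'D_w f p + 'D_w k p *: f p.
Proof.
move=> dk df; have [dkf dkfE] := is_diff_scale dk df.
by rewrite !deriveE // dkfE.
Qed.

Lemma derive_comp (f : U -> V) (g : V -> W) (w p : U) :
  differentiable f p -> differentiable g (f p) ->
  'D_w (g \o f) p = 'd g (f p) ('D_w f p).
Proof.
move=> dfp dgp; rewrite !deriveE //; last exact: differentiable_comp.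
by rewrite diff_comp.
Qed.

End Derive.

Section Projections.
Context (R : realType) (U V W : normedModType R).
Variables (f : U -> V * W) (p : U).
Hypothesis df : differentiable f p.

Let diff_proj (X : normedModType R) (g : {linear (V * W)%type -> X}) w :
  continuous g ->
  differentiable (g \o f) p /\ 'D_w (g \o f) p = g ('D_w f p).
Proof.
move=> cg; have lg := linear_differentiable (f p) cg.
by split; [exact: differentiable_comp|rewrite derive_comp // diff_lin].
Qed.

Lemma differentiable_fst : differentiable (fun q => (f q).1) p.
Proof. by case: (@diff_proj V fst 0) => // ?; exact: cvg_fst. Qed.

Lemma differentiable_snd : differentiable (fun q => (f q).2) p.
Proof. by case: (@diff_proj W snd 0) => // ?; exact: cvg_snd. Qed.

Lemma derive_fst w : 'D_w (fun q => (f q).1) p = ('D_w f p).1.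
Proof. by case: (@diff_proj V fst w) => // ?; exact: cvg_fst. Qed.

Lemma derive_snd w : 'D_w (fun q => (f q).2) p = ('D_w f p).2.
Proof. by case: (@diff_proj W snd w) => // ?; exact: cvg_snd. Qed.

End Projections.

Lemma derive_pair (R : realType) (U V W : normedModType R)
    (f : U -> V) (g : U -> W) (w p : U) :
  differentiable f p -> differentiable g p ->
  'D_w (fun q => (f q, g q)) p = ('D_w f p, 'D_w g p).
Proof.
move=> df dg; rewrite !deriveE //; last exact: differentiable_pair.
by rewrite diff_pair.
Qed.

(** * Second-order chain rule in the parameter plane *)

Section TwiceDifferentiable.
Context (R : realType).
Implicit Type W : normedModType R.

(** The consequence of smoothness that second derivatives of composites require; it is itself stable
    under composition. *)
Definition twice_differentiable W (V : set (dnum R)) (g : dnum R -> W) : Prop :=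
  (forall p, V p -> differentiable g p) /\
  (forall w p, V p -> differentiable ('D_w g) p).

Lemma smooth_twice_differentiable W (V : set (dnum R)) (g : dnum R -> W) :
  smooth V g -> twice_differentiable V g.
Proof. by move=> /(_ 2%N) [dg d2g]; split=> // w; case: (d2g w). Qed.

Lemma diff_plane W (g : dnum R -> W) p w :
  'd g p w = w.1 *: 'd g p (1, 0) + w.2 *: 'd g p (0, 1).
Proof.
rewrite -!linearZ -linearD; congr ('d g p _); case: w => w1 w2 /=.
rewrite -[LHS]/(w1, w2); congr (_, _) => /=;
  by rewrite ?scaler0 ?addr0 ?add0r /GRing.scale /= ?mulr1.
Qed.

Lemma derive_plane W (g : dnum R -> W) w p : differentiable g p ->
  'D_w g p = w.1 *: partial_u g p + w.2 *: partial_v g p.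
Proof. by move=> dg; rewrite /partial_u /partial_v !deriveE // diff_plane. Qed.

Lemma derive_comp_plane W (f : dnum R -> dnum R) (g : dnum R -> W) w p :
  differentiable f p -> differentiable g (f p) ->
  'D_w (g \o f) p = ('D_w f p).1 *: partial_u g (f p)
                  + ('D_w f p).2 *: partial_v g (f p).
Proof.
move=> dfp dgp; rewrite /partial_u /partial_v (derive_comp _ dfp dgp).
by rewrite diff_plane !(deriveE _ dgp).
Qed.

Section Composition.
Variables (W : normedModType R) (V V' : set (dnum R)).
Variables (f : dnum R -> dnum R) (g : dnum R -> W).
Hypotheses (openV : open V) (fV : forall p, V p -> V' (f p)).
Hypotheses (df : twice_differentiable V f) (dg : twice_differentiable V' g).

(** The first-order chain rule is put as an equality of germs so that it can be differentiated once
    more. *)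
Let near_derive_comp w p : V p -> \forall q \near p,
  ('D_w f q).1 *: (partial_u g \o f) q + ('D_w f q).2 *: (partial_v g \o f) q
  = 'D_w (g \o f) q.
Proof.
move=> Vp; have : \forall q \near p, V q by exact: open_nbhs_nbhs.
apply: filterS => q Vq; rewrite (@derive_comp_plane W f g w q) //.
  exact: df.1.
exact: dg.1 (fV Vq).
Qed.

Let differentiable_term (k : dnum R -> R) w p : V p -> differentiable k p ->
  differentiable (fun q => k q *: ('D_w g \o f) q) p.
Proof.
move=> Vp dk; have dgf := differentiable_comp (df.1 _ Vp) (dg.2 w _ (fV Vp)).
by case: (is_diff_scale dk dgf).
Qed.

Let derive_term (k : dnum R -> R) w w' p : V p -> differentiable k p ->
  'D_w' (fun q => k q *: ('D_w g \o f) q) p =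
  k p *: (('D_w' f p).1 *: partial_u ('D_w g) (f p)
          + ('D_w' f p).2 *: partial_v ('D_w g) (f p))
  + 'D_w' k p *: 'D_w g (f p).
Proof.
move=> Vp dk; have dfp := df.1 _ Vp; have dgp := dg.2 w _ (fV Vp).
rewrite (derive_scale _ dk (differentiable_comp dfp dgp)).
by rewrite (derive_comp_plane _ dfp dgp).
Qed.

Lemma twice_differentiable_comp : twice_differentiable V (g \o f).
Proof.
split=> [p Vp|w p Vp].
  exact: differentiable_comp (df.1 _ Vp) (dg.1 _ (fV Vp)).
have d2f := df.2 w _ Vp.
apply: near_eq_differentiable (near_derive_comp w Vp) _.
apply: differentiableD; apply: differentiable_term => //.
  exact: differentiable_fst.
exact: differentiable_snd.
Qed.

(** Product rule applied to the first-order chain rule. The second derivatives of [f] multiply only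
    first partials of [g]; they are collected in the last summand, which is tangent when [g] is a
    surface. *)
Lemma derive2_comp_plane w w' p : V p ->
  'D_w' ('D_w (g \o f)) p =
    ('D_w f p).1 *: (('D_w' f p).1 *: partial_u (partial_u g) (f p)
                   + ('D_w' f p).2 *: partial_v (partial_u g) (f p))
  + ('D_w f p).2 *: (('D_w' f p).1 *: partial_u (partial_v g) (f p)
                   + ('D_w' f p).2 *: partial_v (partial_v g) (f p))
  + (('D_w' ('D_w f) p).1 *: partial_u g (f p)
   + ('D_w' ('D_w f) p).2 *: partial_v g (f p)).
Proof.
move=> Vp; have d2f := df.2 w _ Vp.
have d1 := differentiable_fst d2f; have d2 := differentiable_snd d2f.
have d3 := differentiable_term _ Vp d1; have d4 := differentiable_term _ Vp d2.
rewrite -(near_eq_derive _ (near_derive_comp w Vp)) deriveD; last 2 first.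
- exact: diff_derivable (d3 _).
- exact: diff_derivable (d4 _).
rewrite (derive_term _ _ Vp d1) (derive_term _ _ Vp d2).
by rewrite derive_fst // derive_snd // addrACA.
Qed.

End Composition.
End TwiceDifferentiable.

(** * Locally constant functions and vanishing derivatives *)

(** The level set through [p] is both open and closed relative to [A]. The interiors of the sets of
    points that, if in [A], have value [f p], respectively a different value, provide the open sets
    witnessing this. *)
Lemma locally_constant_connected (T : topologicalType) (Y : Type) (A : set T)
    (f : T -> Y) : connected A ->
  (forall p, A p -> \forall q \near p, A q -> f q = f p) ->
  forall p q, A p -> A q -> f q = f p.
Proof.
move=> cA lf p q Ap Aq.
suff E : A `&` [set r | f r = f p] = A by move: Aq; rewrite -E => -[].
apply: cA; first by exists p.
  exists [set r | A r -> f r = f p]°; first exact: open_interior.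
  apply/seteqP; split=> r [Ar].
    by move=> /= frp; split=> //; rewrite -frp; exact: lf.
  by move=> /nbhs_singleton /(_ Ar).
exists (~` [set r | A r -> f r <> f p]°).
  exact: open_closedC (open_interior _).
apply/seteqP; split=> r [Ar].
  by move=> frp; split=> // /nbhs_singleton /(_ Ar).
move=> nr; split=> //; apply: contrapT => frp; apply: nr.
by apply: filterS (lf _ Ar) => r' + Ar' => /(_ Ar') ->.
Qed.

(** On a ball around [p], the mean value theorem is applied along the segment [l] from [p] to [q],
    which stays in the ball. *)
Lemma derive0_locally_constant (R : realType) (V : normedModType R)
    (f : V -> R) p :
  (\forall q \near p, differentiable f q /\ forall w, 'D_w f q = 0) ->
  \forall q \near p, f q = f p.
Proof.
move=> /nbhs_ballP[e e0 fe]; apply/nbhs_ballP; exists e => // q pq.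
pose l (r : R) : V := r *: (q - p) + p.
have dl r : differentiable l r by [].
have le_e (r : R) : 0 <= r <= 1 -> ball p e (l r).
  move: pq; rewrite -ball_normE /= => pq /andP[r0 r1].
  rewrite /l opprD addrCA subrr addr0 normrN normrZ ger0_norm //.
  by rewrite distrC in pq; apply: le_lt_trans pq; rewrite ler_piMl.
have dfl (r : R) : 0 <= r <= 1 -> differentiable (f \o l) r.
  by move=> /le_e /fe[df _]; exact: differentiable_comp.
have fl' (r : R) : r \in `]0, 1[ -> is_derive r 1 (f \o l) 0.
  rewrite in_itv /= => /andP[r0 r1].
  have r01 : 0 <= r <= 1 by rewrite !ltW.
  have [df f'0] := fe _ (le_e _ r01).
  apply: DeriveDef; first exact: diff_derivable (dfl _ r01).
  by rewrite derive_comp // -deriveE.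
have cfl : {within `[0, 1], continuous (f \o l)}.
  apply: continuous_in_subspaceT => r; rewrite inE /= in_itv /= => r01.
  exact: differentiable_continuous (dfl _ r01).
have [c _] := MVT ltr01 fl' cfl.
rewrite mul0r /l /= scale1r scale0r add0r subrK => /eqP.
by rewrite subr_eq0 => /eqP.
Qed.

(** Connectedness is used on the source [A] of [s]: each component of [f] is locally constant on the
    open image, and continuity of [s] carries this back to [A]. *)
Lemma derive0_constant (R : realType) (U V : normedModType R) (A : set U)
    (s : U -> V) (f : V -> dnum R) :
  connected A -> open (s @` A) -> (forall p, A p -> {for p, continuous s}) ->
  (forall q, (s @` A) q -> differentiable f q /\ forall w, 'D_w f q = 0) ->
  forall p q, A p -> A q -> f (s q) = f (s p).
Proof.
move=> cA oA cs df.
apply: (locally_constant_connected cA (f := f \o s)) => p Ap.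
have sA : \forall q \near s p, (s @` A) q.
  by apply: open_nbhs_nbhs; split=> //; exists p.
have f1 : \forall q \near s p, (f q).1 = (f (s p)).1.
  apply: (@derive0_locally_constant _ _ (fun q => (f q).1)).
  apply: filterS sA => q /df [dfq f0]; split=> [|w].
    exact: differentiable_fst.
  by rewrite derive_fst // f0.
have f2 : \forall q \near s p, (f q).2 = (f (s p)).2.
  apply: (@derive0_locally_constant _ _ (fun q => (f q).2)).
  apply: filterS sA => q /df [dfq f0]; split=> [|w].
    exact: differentiable_snd.
  by rewrite derive_snd // f0.
have fs : \forall q \near s p, f q = f (s p).
  near=> q.
  rewrite [LHS]surjective_pairing [RHS]surjective_pairing.
  by congr (_, _); near: q.
have := cs _ Ap _ fs; rewrite nbhs_filterE /= => fsp.
by apply: filterS fsp => q fq _.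
Unshelve. all: by end_near. Qed.

(** * Algebra of conformal linear maps of the Lorentzian plane *)

Section Conformal.
Context (R : realFieldType) (a b c d e : R).
Hypotheses (diag : a ^+ 2 - c ^+ 2 = d ^+ 2 - b ^+ 2) (offdiag : a * b = c * d).
Hypotheses (pos : 0 < a ^+ 2 - c ^+ 2) (e2 : e ^+ 2 = 1).

Let m := a ^+ 2 - c ^+ 2.

(** [diag] and [offdiag] say that the matrix with columns (a, c) and (b, d) multiplies the
    Lorentzian form by [m], so its squared determinant is [m ^+ 2]. *)
Let jac2 : (a * d - b * c) ^+ 2 = m ^+ 2.
Proof.
have -> : m ^+ 2 = (a ^+ 2 - c ^+ 2) * (d ^+ 2 - b ^+ 2) by rewrite -diag.
have -> : (a ^+ 2 - c ^+ 2) * (d ^+ 2 - b ^+ 2) =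
  (a * d) ^+ 2 + (b * c) ^+ 2 - (a * b) ^+ 2 - (c * d) ^+ 2 by ring.
have -> : (a * b) ^+ 2 = a * b * (c * d) by rewrite expr2 {2}offdiag.
have -> : (c * d) ^+ 2 = a * b * (c * d) by rewrite expr2 -{1}offdiag.
ring.
Qed.

(** By positivity [e] times the Jacobian is the positive root [m]. Multiplying [d] and [b] by the
    Jacobian gives [a * m] and [c * m], and [m] cancels. *)
Lemma conformal_cauchy_riemann :
  0 < e * (a * d - b * c) -> d = e * a /\ b = e * c.
Proof.
move=> J0; have Jm : e * (a * d - b * c) = m.
  apply/eqP; rewrite -(eqrXn2 (n := 2)) ?ltW // exprMn e2 mul1r.
  exact/eqP.
have m0 : m != 0 by rewrite gt_eqF.
have dE : d * (a * d - b * c) = a * m.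
  have -> : d * (a * d - b * c) = a * d ^+ 2 - b * (c * d) by ring.
  by rewrite -offdiag /m diag; ring.
have bE : b * (a * d - b * c) = c * m.
  have -> : b * (a * d - b * c) = a * b * d - b ^+ 2 * c by ring.
  by rewrite offdiag /m diag; ring.
split; apply: (mulIf m0).
  by rewrite -mulrA -dE -Jm; ring.
by rewrite -mulrA -bE -Jm; ring.
Qed.

End Conformal.

(** * The Minkowski product: bilinearity and nondegeneracy *)

Section Mdot.
Context (R : realType) (n : nat).
Implicit Types a b e : 'rV[R]_n.

Lemma mdotC a b : mdot a b = mdot b a.
Proof. by apply: eq_bigr => i _; rewrite mulrC. Qed.

Lemma mdotDl a b e : mdot (a + b) e = mdot a e + mdot b e.
Proof.
rewrite -big_split; apply: eq_bigr => i _ /=.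
by case: ifP => _; rewrite !mxE ?mulrDl ?opprD.
Qed.

Lemma mdotZl (k : R) a e : mdot (k *: a) e = k * mdot a e.
Proof.
rewrite [RHS]mulr_sumr; apply: eq_bigr => i _ /=.
by case: ifP => _; rewrite !mxE ?mulrN mulrA.
Qed.

Lemma mdotNl a e : mdot (- a) e = - mdot a e.
Proof. by rewrite -scaleN1r mdotZl mulN1r. Qed.

Lemma mdotDr a b e : mdot e (a + b) = mdot e a + mdot e b.
Proof. by rewrite mdotC mdotDl !(mdotC _ e). Qed.

Lemma mdotZr (k : R) a e : mdot e (k *: a) = k * mdot e a.
Proof. by rewrite mdotC mdotZl (mdotC _ e). Qed.

Lemma mdotNr a e : mdot e (- a) = - mdot e a.
Proof. by rewrite mdotC mdotNl (mdotC _ e). Qed.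

Lemma mdot_nondegenerate a : (forall b, mdot a b = 0) -> a = 0.
Proof.
move=> a0; apply/rowP => i; have := a0 (delta_mx 0 i).
rewrite /mdot (bigD1 i) //= big1 => [|j /negPf ji]; last first.
  by rewrite !mxE eqxx /= ji mulr0 oppr0 if_same.
rewrite !mxE !eqxx mulr1 addr0; case: ifP => _ // /eqP.
by rewrite oppr_eq0 => /eqP.
Qed.

End Mdot.

Definition mdotE := (mdotDl, mdotDr, mdotNl, mdotNr, mdotZl, mdotZr).

(** * Orthogonal projection to the normal space in an isothermal frame *)

Section NormalProjection.
Context (R : realType) (n : nat) (e1 e2 : 'rV[R]_n) (l : R).

Definition isothermal_frame : Prop :=
  [/\ mdot e1 e1 = - l, mdot e2 e2 = l, mdot e1 e2 = 0 & 0 < l].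

(** For an [isothermal_frame], the projection along the span of [e1] and [e2]; the plus sign at [e1]
    comes from [mdot e1 e1 = - l]. *)
Definition normal_proj (a : 'rV[R]_n) : 'rV[R]_n :=
  a + (mdot a e1 / l) *: e1 - (mdot a e2 / l) *: e2.

Lemma normal_projD a b : normal_proj (a + b) = normal_proj a + normal_proj b.
Proof. by apply/rowP => i; rewrite /normal_proj !mdotE !mxE; ring. Qed.

Lemma normal_projZ k a : normal_proj (k *: a) = k *: normal_proj a.
Proof. by apply/rowP => i; rewrite /normal_proj !mdotE !mxE; ring. Qed.

Lemma normal_projDZ k1 k2 a b :
  normal_proj (k1 *: a + k2 *: b) = k1 *: normal_proj a + k2 *: normal_proj b.
Proof. by rewrite normal_projD !normal_projZ. Qed.

Lemma normal_projZD k a b :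
  normal_proj (k *: (a + b)) = k *: (normal_proj a + normal_proj b).
Proof. by rewrite normal_projZ normal_projD. Qed.

Hypothesis frame : isothermal_frame.

Let l0 : l != 0. Proof. by case: frame => _ _ _ /lt0r_neq0. Qed.

Lemma normal_proj1 : normal_proj e1 = 0.
Proof.
case: frame => E11 _ E12 _.
rewrite /normal_proj E11 E12 mulNr divff // mul0r scale0r subr0.
by rewrite scaleN1r subrr.
Qed.

Lemma normal_proj2 : normal_proj e2 = 0.
Proof.
case: frame => _ E22 E12 _.
rewrite /normal_proj E22 mdotC E12 divff // mul0r scale0r addr0.
by rewrite scale1r subrr.
Qed.

(** Fitted to the second-order chain rule, whose last summand is tangent and therefore projected to
    zero. *)
Lemma normal_proj_modulo (k1 k2 : R) (a b : 'rV[R]_n) (m1 m2 : R) :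
  normal_proj (k1 *: a + k2 *: b + (m1 *: e1 + m2 *: e2)) =
  k1 *: normal_proj a + k2 *: normal_proj b.
Proof.
rewrite !normal_projD !normal_projZ normal_proj1 normal_proj2.
by rewrite !scaler0 !addr0.
Qed.

Lemma mdot1_normal_proj a : mdot e1 (normal_proj a) = 0.
Proof.
case: frame => E11 _ E12 _.
by rewrite /normal_proj !mdotE E11 E12 (mdotC a e1); field.
Qed.

Lemma mdot2_normal_proj a : mdot e2 (normal_proj a) = 0.
Proof.
case: frame => _ E22 E12 _.
by rewrite /normal_proj !mdotE E22 (mdotC e2 e1) E12 (mdotC a e2); field.
Qed.

Variables (x : dnum R -> 'rV[R]_n) (p : dnum R).
Hypothesis normalE :
  forall b, surface_normal x p b <-> mdot e1 b = 0 /\ mdot e2 b = 0.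

Let normal_proj_normal a : surface_normal x p (normal_proj a).
Proof.
by apply/normalE; split; [exact: mdot1_normal_proj|exact: mdot2_normal_proj].
Qed.

Let mdot_sub_proj a b : surface_normal x p b -> mdot (a - normal_proj a) b = 0.
Proof.
move=> /normalE [b1 b2]; rewrite /normal_proj !mdotE b1 b2; ring.
Qed.

(** The product is nondegenerate on the normal space: any [a] splits into a normal vector and a
    remainder orthogonal to all normals, so [b] is orthogonal to every [a]. *)
Let normal_eq0 b : surface_normal x p b ->
  (forall c, surface_normal x p c -> mdot b c = 0) -> b = 0.
Proof.
move=> nb b0; apply: mdot_nondegenerate => a.
rewrite -[a](subrK (normal_proj a)) mdotDr (b0 (normal_proj a)) //.
by rewrite addr0 mdotC mdot_sub_proj.
Qed.

(** [normal_part] is a choice, so its value follows from uniqueness, which nondegeneracy on the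
    normal space gives for each of the two components. *)
Lemma normal_partE (a : dvec R n) :
  normal_part x p a = (normal_proj a.1, normal_proj a.2).
Proof.
have ddot_sub b c : normal_dspan x p c ->
    ddot (a - b) c = ddot ((normal_proj a.1, normal_proj a.2) - b : dvec R n) c.
  move=> [c1 c2]; rewrite /ddot /=.
  have E (u : 'rV_n) v w : surface_normal x p w ->
      mdot (u - v) w = mdot (normal_proj u - v) w.
    by move=> nw; have := mdot_sub_proj u nw; rewrite !mdotE => E; lra.
  by rewrite !(E a.1 _ _ c1) !(E a.1 _ _ c2) !(E a.2 _ _ c1) !(E a.2 _ _ c2).
have nP : normal_dspan x p (normal_proj a.1, normal_proj a.2).
  by split; exact: normal_proj_normal.
rewrite /normal_part; apply: xget_unique => [|b [nb ab]].
  split=> // c nc; rewrite ddot_sub // subrr /ddot /=.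
  (* The zero vector is written as [0 *: 0] so that the linearity rules evaluate its products. *)
  by rewrite -(scale0r 0) !mdotE !mul0r addr0.
have n0 : surface_normal x p 0.
  by apply/normalE; rewrite -(scale0r 0) !mdotE !mul0r.
have nB (u v : 'rV_n) : surface_normal x p u -> surface_normal x p v ->
    surface_normal x p (u - v).
  move=> /normalE[u1 u2] /normalE[v1 v2].
  by apply/normalE; rewrite !mdotE u1 u2 v1 v2 subr0.
have ab0 c : surface_normal x p c ->
    mdot (normal_proj a.1 - b.1) c = 0 /\ mdot (normal_proj a.2 - b.2) c = 0.
  (* Testing against the real normal vector [(c, 0)] separates the two components. *)
  move=> nc; have := ab (c, 0) (conj nc n0); rewrite ddot_sub // /ddot /=.
  by rewrite -(scale0r 0) !mdotE !mul0r !addr0 !add0r => -[].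
have [nb1 nb2] := nb.
have E1 : normal_proj a.1 - b.1 = 0.
  by apply: normal_eq0 => [|c /ab0 []//]; exact: nB.
have E2 : normal_proj a.2 - b.2 = 0.
  by apply: normal_eq0 => [|c /ab0 []//]; exact: nB.
by rewrite (subr0_eq E1) (subr0_eq E2) -surjective_pairing.
Qed.

End NormalProjection.

(** * [Phi'] and its normal part through second partial derivatives *)

Lemma eq_on_derive (R : realType) (V W : normedModType R) (A : set V)
    (f g : V -> W) w :
  open A -> (forall q, A q -> f q = g q) ->
  forall q, A q -> 'D_w f q = 'D_w g q.
Proof.
move=> oA fg q Aq; apply: near_eq_derive.
have : \forall r \near q, A r by exact: open_nbhs_nbhs.
by apply: filterS.
Qed.

Section Surface.
Context (R : realType) (n : nat).
Implicit Types (x y z : dnum R -> 'rV[R]_n) (A : set (dnum R)).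

(** The real part of [Phi']; [half_mixed] is its j part. *)
Definition half_laplacian x p : 'rV[R]_n :=
  2^-1 *: (partial_u (partial_u x) p + partial_v (partial_v x) p).

Definition half_mixed x p : 'rV[R]_n :=
  2^-1 *: (partial_u (partial_v x) p + partial_v (partial_u x) p).

Lemma derive_dvec_of x p w : differentiable x p ->
  'D_w (fun q => dvec_of (x q)) p = ('D_w x p, 0).
Proof.
move=> dx; rewrite /dvec_of (derive_pair _ dx) ?derive_cst //.
Qed.

Lemma PhiE x p : differentiable x p -> Phi x p = (partial_u x p, partial_v x p).
Proof.
move=> dx; rewrite /Phi /partial_t scalerA divff ?pnatr_eq0 // scale1r.
rewrite /partial_u /partial_v !(derive_dvec_of _ dx) /mulj /=.
by rewrite -[LHS]/(_ + 0, 0 + _) addr0 add0r.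
Qed.

Lemma partial_t_Phi A x p : open A -> twice_differentiable A x -> A p ->
  partial_t (Phi x) p = (half_laplacian x p, half_mixed x p).
Proof.
move=> oA [dx d2x] Ap; rewrite /partial_t /partial_u /partial_v.
have PE q : A q -> Phi x q = (partial_u x q, partial_v x q).
  by move=> Aq; apply: PhiE; exact: dx.
rewrite !(eq_on_derive _ oA PE Ap).
rewrite !derive_pair; [|exact: d2x..].
by [].
Qed.

(** The frame may be any isothermal one with the right normal space, not only the partials of [x],
    so that one frame can serve two coordinate variables. *)
Lemma dPhi_perp2E A x p e1 e2 l a b :
  open A -> twice_differentiable A x -> A p ->
  isothermal_frame e1 e2 l ->
  (forall r, surface_normal x p r <-> mdot e1 r = 0 /\ mdot e2 r = 0) ->
  normal_proj e1 e2 l (half_laplacian x p) = a ->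
  normal_proj e1 e2 l (half_mixed x p) = b ->
  dPhi_perp2 x p = (mdot a a + mdot b b, mdot a b + mdot a b).
Proof.
move=> oA d2x Ap frame nE <- <-; rewrite /dPhi_perp2 (partial_t_Phi oA d2x Ap).
by rewrite (normal_partE frame nE) /ddot [X in _ = (_, _ + X)]mdotC.
Qed.

Lemma surface_normalE x p b : differentiable x p ->
  surface_normal x p b <->
  mdot (partial_u x p) b = 0 /\ mdot (partial_v x p) b = 0.
Proof.
move=> dx; rewrite /partial_u /partial_v !deriveE //; split.
  by move=> nb; split; apply: nb; eexists.
move=> [b1 b2] _ [w _ <-].
by rewrite diff_plane !mdotE b1 b2 !mulr0 addr0.
Qed.

End Surface.

(** * Linear change of an isothermal tangent frame *)

Section FrameChange.
Context (R : realType) (n : nat) (e1 e2 : 'rV[R]_n) (a b c d : R).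

Let z1 := a *: e1 + c *: e2.
Let z2 := b *: e1 + d *: e2.

(** Expanded in the old frame, every product of [z1] and [z2] carries the factor [l], which is
    positive and cancels. *)
Lemma isothermal_frame_change (l : R) : isothermal_frame e1 e2 l ->
  mdot z1 z1 = - mdot z2 z2 -> mdot z1 z2 = 0 -> mdot z1 z1 < 0 ->
  [/\ a ^+ 2 - c ^+ 2 = d ^+ 2 - b ^+ 2, a * b = c * d & 0 < a ^+ 2 - c ^+ 2].
Proof.
rewrite /z1 /z2 => -[E11 E22 E12 l0]; have E21 := mdotC e2 e1.
rewrite E12 in E21; rewrite !mdotE E11 E22 E12 E21 => E F Eneg.
have l0' : l != 0 by rewrite gt_eqF.
by split; [apply: (mulIf l0'); lra|apply: (mulIf l0'); lra|];
  rewrite -(pmulr_lgt0 _ l0); lra.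
Qed.

(** Cramer's rule: an invertible change of frame keeps the orthogonal complement. *)
Lemma orthogonal_frame_change (r : 'rV[R]_n) : a * d - b * c != 0 ->
  mdot z1 r = 0 /\ mdot z2 r = 0 <-> mdot e1 r = 0 /\ mdot e2 r = 0.
Proof.
move=> J0; rewrite /z1 /z2 !mdotE.
split=> [[N1 N2]|[-> ->]]; last by rewrite !mulr0 addr0.
split; apply: (mulIf J0).
  transitivity (d * (a * mdot e1 r + c * mdot e2 r)
                - c * (b * mdot e1 r + d * mdot e2 r)); first by ring.
  by rewrite N1 N2; ring.
transitivity (a * (b * mdot e1 r + d * mdot e2 r)
              - b * (a * mdot e1 r + c * mdot e2 r)); first by ring.
by rewrite N1 N2; ring.
Qed.

End FrameChange.

(** * Effect of a holomorphic or antiholomorphic change on the normal part of [Phi'] *)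

Section CanonicalScale.
Context (R : realType) (n : nat) (a c e : R).
Hypothesis e2 : e ^+ 2 = 1.

(** [a ^+ 2 + c ^+ 2] and [2 * a * c] are the two parts of (a + j c)^2. Together with
    [half_mixed_change] this multiplies the normal part of [Phi'] by (a + j c)^2, followed by
    conjugation when [e] is -1. *)
Lemma half_laplacian_change (p11 p12 p21 p22 : 'rV[R]_n) :
  2^-1 *: ((a *: (a *: p11 + c *: p12) + c *: (a *: p21 + c *: p22))
    + ((e * c) *: ((e * c) *: p11 + (e * a) *: p12)
       + (e * a) *: ((e * c) *: p21 + (e * a) *: p22)))
  = (a ^+ 2 + c ^+ 2) *: (2^-1 *: (p11 + p22))
    + (2 * a * c) *: (2^-1 *: (p21 + p12)).
Proof.
apply/rowP => i; rewrite !mxE.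
transitivity (2^-1 * ((a ^+ 2 + e ^+ 2 * c ^+ 2) * p11 0 i
  + (a * c + e ^+ 2 * a * c) * (p12 0 i + p21 0 i)
  + (c ^+ 2 + e ^+ 2 * a ^+ 2) * p22 0 i)); first by ring.
by rewrite e2; field.
Qed.

Lemma half_mixed_change (p11 p12 p21 p22 : 'rV[R]_n) :
  2^-1 *: (((e * c) *: (a *: p11 + c *: p12) + (e * a) *: (a *: p21 + c *: p22))
    + (a *: ((e * c) *: p11 + (e * a) *: p12)
       + c *: ((e * c) *: p21 + (e * a) *: p22)))
  = e *: ((2 * a * c) *: (2^-1 *: (p11 + p22))
    + (a ^+ 2 + c ^+ 2) *: (2^-1 *: (p21 + p12))).
Proof. by apply/rowP => i; rewrite !mxE; field. Qed.

(* With m = (a + j c)^2, the two equations say that m ^ 2 = 1 in the double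
   numbers, and [pos] excludes the roots a + j c = j and a + j c = - j. *)
Lemma canonical_scale (p q : 'rV[R]_n) :
  0 < a ^+ 2 - c ^+ 2 ->
  let p' := (a ^+ 2 + c ^+ 2) *: p + (2 * a * c) *: q in
  let q' := e *: ((2 * a * c) *: p + (a ^+ 2 + c ^+ 2) *: q) in
  mdot p p + mdot q q = 1 -> mdot p q + mdot p q = 0 ->
  mdot p' p' + mdot q' q' = 1 -> mdot p' q' + mdot p' q' = 0 ->
  a ^+ 2 = 1 /\ c = 0.
Proof.
move=> pos /=; rewrite !mdotE (mdotC q p) => N1 N2 M1 M2.
have N3 : mdot p q = 0 by lra.
rewrite N3 in M1 M2.
(* This product is half the j part of (a + j c)^4, and the new [M1] below is the real part; [N1] and
   [N3] normalize the old value to 1. *)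
have {}M2 : (a ^+ 2 + c ^+ 2) * (2 * a * c) = 0.
  have : e * ((a ^+ 2 + c ^+ 2) * (2 * a * c) * (mdot p p + mdot q q)) = 0.
    by lra.
  rewrite N1 mulr1 => /(congr1 ( *%R e)).
  by rewrite mulrA -expr2 e2 mul1r mulr0.
have {}M1 : (a ^+ 2 + c ^+ 2) ^+ 2 + (2 * a * c) ^+ 2 = 1.
  transitivity (((a ^+ 2 + c ^+ 2) ^+ 2 + (2 * a * c) ^+ 2)
                * (mdot p p + mdot q q)); first by rewrite N1 mulr1.
  rewrite -[RHS]M1; transitivity ((a ^+ 2 + c ^+ 2) ^+ 2 * mdot p p
    + (2 * a * c) ^+ 2 * mdot q q
    + e ^+ 2 * ((2 * a * c) ^+ 2 * mdot p p
                + (a ^+ 2 + c ^+ 2) ^+ 2 * mdot q q)).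
    by rewrite e2; ring.
  by ring.
have c2 : 0 <= c ^+ 2 := sqr_ge0 _.
have a0 : a != 0.
  by apply: contraTneq pos => ->; rewrite expr0n /= sub0r oppr_gt0 -leNgt.
have s0 : a ^+ 2 + c ^+ 2 != 0 by rewrite gt_eqF //; lra.
have c0 : c = 0.
  apply/eqP; move/eqP: M2; rewrite mulf_eq0 (negPf s0) /= !mulf_eq0.
  by rewrite pnatr_eq0 (negPf a0).
split=> //; move: M1; rewrite c0 mulr0 !expr0n /= !addr0 => /eqP.
by rewrite sqrf_eq1 => /orP[/eqP//|/eqP aN]; have := sqr_ge0 a; lra.
Qed.

End CanonicalScale.

(** * Change between canonical variables at one point *)

Section ChangeOfVariable.
Context (R : realType) (n : nat) (A B : set (dnum R)).
Variables (T : dnum R -> dnum R) (y z : dnum R -> 'rV[R]_n).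
Hypotheses (oA : open A) (oB : open B) (AB : forall q, A q -> B (T q)).
Hypotheses (d2T : twice_differentiable A T) (d2y : twice_differentiable B y).
Hypotheses (d2z : twice_differentiable A z).
Hypothesis zE : forall q, A q -> z q = (y \o T) q.

Variable q : dnum R.
Hypothesis Aq : A q.

Let a := (partial_u T q).1.
Let c := (partial_u T q).2.
Let b := (partial_v T q).1.
Let d := (partial_v T q).2.
Let e1 := partial_u y (T q).
Let e2 := partial_v y (T q).

Let derive_z w : 'D_w z q = ('D_w T q).1 *: e1 + ('D_w T q).2 *: e2.
Proof.
rewrite (eq_on_derive w oA zE Aq); apply: derive_comp_plane.
  exact: d2T.1.
exact: d2y.1 (AB Aq).
Qed.

Let partial_u_z : partial_u z q = a *: e1 + c *: e2.
Proof. exact: derive_z. Qed.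

Let partial_v_z : partial_v z q = b *: e1 + d *: e2.
Proof. exact: derive_z. Qed.

Let derive2_z w w' : 'D_w' ('D_w z) q = 'D_w' ('D_w (y \o T)) q.
Proof.
by apply: (eq_on_derive _ oA _ Aq) => r Ar; exact: (eq_on_derive w oA zE Ar).
Qed.

Variable l : R.
Hypothesis frame : isothermal_frame e1 e2 l.

Let P := normal_proj e1 e2 l.

(** The second derivatives of [T] disappear here, since they contribute only combinations of [e1]
    and [e2]. *)
Let P_derive2_z w w' : P ('D_w' ('D_w z) q) =
  ('D_w T q).1 *: (('D_w' T q).1 *: P (partial_u (partial_u y) (T q))
                   + ('D_w' T q).2 *: P (partial_v (partial_u y) (T q)))
  + ('D_w T q).2 *: (('D_w' T q).1 *: P (partial_u (partial_v y) (T q))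
                   + ('D_w' T q).2 *: P (partial_v (partial_v y) (T q))).
Proof.
rewrite derive2_z (derive2_comp_plane oA AB d2T d2y _ _ Aq) -/e1 -/e2.
apply: etrans (normal_proj_modulo frame _ _ _ _ _ _) _.
congr (_ *: _ + _ *: _).
exact: normal_projDZ.
exact: normal_projDZ.
Qed.

Let p11 := P (partial_u (partial_u y) (T q)).
Let p12 := P (partial_v (partial_u y) (T q)).
Let p21 := P (partial_u (partial_v y) (T q)).
Let p22 := P (partial_v (partial_v y) (T q)).

Let P_half_laplacian_z : P (half_laplacian z q) =
  2^-1 *: ((a *: (a *: p11 + c *: p12) + c *: (a *: p21 + c *: p22))
           + (b *: (b *: p11 + d *: p12) + d *: (b *: p21 + d *: p22))).
Proof.
rewrite /half_laplacian /P normal_projZD -/P.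
by congr (_ *: (_ + _)); exact: P_derive2_z.
Qed.

Let P_half_mixed_z : P (half_mixed z q) =
  2^-1 *: ((b *: (a *: p11 + c *: p12) + d *: (a *: p21 + c *: p22))
           + (a *: (b *: p11 + d *: p12) + c *: (b *: p21 + d *: p22))).
Proof.
rewrite /half_mixed /P normal_projZD -/P.
by congr (_ *: (_ + _)); exact: P_derive2_z.
Qed.

Let PA := P (half_laplacian y (T q)).
Let PB := P (half_mixed y (T q)).

Let PAE : 2^-1 *: (p11 + p22) = PA.
Proof. by rewrite /PA /half_laplacian /P normal_projZD. Qed.

Let PBE : 2^-1 *: (p21 + p12) = PB.
Proof. by rewrite /PB /half_mixed /P normal_projZD. Qed.

Hypothesis iso_z : [/\ Defs.coefE z q = - coefG z q, coefF z q = 0 &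
  Defs.coefE z q < 0].
Hypothesis can_y : dPhi_perp2 y (T q) = dnum1.
Hypothesis can_z : dPhi_perp2 z q = dnum1.
Variable e : R.
Hypotheses (sqr_e : e ^+ 2 = 1) (jac : 0 < e * jacobian_det T q).

(** The frame [e1], [e2] of [y] at [T q] computes both canonical conditions; the Cauchy-Riemann
    equations then reduce their comparison to [canonical_scale]. *)
Lemma canonical_change :
  [/\ a ^+ 2 = 1, partial_u T q = (a, 0) & partial_v T q = (0, e * a)].
Proof.
have jac' : 0 < e * (a * d - b * c) := jac.
have [diag off pos] : [/\ a ^+ 2 - c ^+ 2 = d ^+ 2 - b ^+ 2, a * b = c * d &
    0 < a ^+ 2 - c ^+ 2].
  case: iso_z; rewrite /Defs.coefE /coefF /coefG partial_u_z partial_v_z.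
  exact: (isothermal_frame_change frame).
have [dE bE] := conformal_cauchy_riemann diag off pos sqr_e jac'.
have J0 : a * d - b * c != 0.
  by apply: contraTneq jac' => ->; rewrite mulr0 ltxx.
have normal_y r : surface_normal y (T q) r <-> mdot e1 r = 0 /\ mdot e2 r = 0.
  by apply: surface_normalE; exact: d2y.1 (AB Aq).
have normal_z r : surface_normal z q r <-> mdot e1 r = 0 /\ mdot e2 r = 0.
  rewrite (surface_normalE _ (d2z.1 _ Aq)) partial_u_z partial_v_z.
  exact: orthogonal_frame_change.
have Tu : partial_u T q = (a, c) := surjective_pairing _.
have Tv : partial_v T q = (b, d) := surjective_pairing _.
have PzA := P_half_laplacian_z; have PzB := P_half_mixed_z.
have [PyA PyB] := (PAE, PBE).
have := can_y.
rewrite (dPhi_perp2E oB d2y (AB Aq) frame normal_y (erefl PA) (erefl PB)).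
move=> -[N1 N2].
have := can_z; rewrite (dPhi_perp2E oA d2z Aq frame normal_z PzA PzB).
(* Without their bodies [b] and [d] are variables, which [bE] and [dE] replace by [e * c] and
   [e * a]. *)
rewrite Tu Tv; clearbody PA PB p11 p12 p21 p22 a b c d; subst b d.
rewrite (half_laplacian_change _ _ sqr_e) half_mixed_change PyA PyB.
move=> -[M1 M2]; have [a2 c0] := canonical_scale sqr_e pos N1 N2 M1 M2.
by split; rewrite ?c0 ?mulr0.
Qed.

End ChangeOfVariable.

(** * Linear parts of the transition maps, and auxiliary facts *)

(** With both factors equal to 1 or -1 this covers the identity, the conjugation and their opposites
    at once. *)
Definition dscale (R : realType) (k1 k2 : R) (q : dnum R) : dnum R :=
  (k1 *: q.1, k2 *: q.2).

Section Dscale.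
Context (R : realType).
Variables (k1 k2 : R) (q : dnum R).

Let diff_id : differentiable (id : dnum R -> dnum R) q.
Proof. exact: ex_diff. Qed.

Lemma differentiable_dscale : differentiable (dscale k1 k2) q.
Proof.
apply: differentiable_pair; apply: differentiableZ.
  exact: differentiable_fst diff_id.
exact: differentiable_snd diff_id.
Qed.

Lemma derive_dscale w : 'D_w (dscale k1 k2) q = dscale k1 k2 w.
Proof.
have d1 := differentiable_fst diff_id; have d2 := differentiable_snd diff_id.
rewrite /dscale (derive_pair _ (differentiableZ _ d1) (differentiableZ _ d2)).
rewrite !deriveZ; [|exact: diff_derivable..].
by rewrite (derive_fst diff_id) (derive_snd diff_id) derive_id.
Qed.

End Dscale.

Lemma smooth_subset (R : realType) (V W : normedModType R) (A B : set V)
    (f : V -> W) : A `<=` B -> smooth B f -> smooth A f.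
Proof.
move=> AB sf k; have := sf k; elim: k f {sf} => [|k IHk] f /=.
  by move=> cf p /AB; exact: cf.
by move=> [df d2f]; split=> [p /AB|w]; [exact: df|apply: IHk; exact: d2f].
Qed.

(** Distinct signs are at distance 2; hence a continuous sign is locally constant. *)
Lemma sign_eq (R : realDomainType) (a b : R) :
  a ^+ 2 = 1 -> b ^+ 2 = 1 -> `|a - b| < 1 -> a = b.
Proof.
move=> /eqP + /eqP; rewrite !sqrf_eq1 ltr_norml.
by move=> /orP[]/eqP-> /orP[]/eqP-> // /andP[l1 l2]; lra.
Qed.

(** * The transition map of two canonical variables on a connected set *)

Section Transition.
Context (R : realType) (n : nat) (D U : set (dnum R)).
Variables (x : dnum R -> 'rV[R]_n) (t phit s phis : dnum R -> dnum R) (e : R).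
Hypotheses (smooth_x : smooth D x) (conn_U : connected U).
Hypothesis can_t : canonical_coordinates D x U t phit.
Hypothesis can_s : canonical_coordinates D x U s phis.
Hypothesis sqr_e : e ^+ 2 = 1.
Hypothesis jac :
  forall q, (s @` U) q -> 0 < e * jacobian_det (t \o phis) q.

Let T := t \o phis.

Let smooth_t : smooth U t. Proof. by case: can_t => -[[_ []]]. Qed.
Let smooth_phit : smooth (t @` U) phit. Proof. by case: can_t => -[[_ []]]. Qed.
Let phitK p : U p -> phit (t p) = p.
Proof. by case: can_t => -[[_ []]] + *; apply. Qed.
Let open_tU : open (t @` U). Proof. by case: can_t => -[[[]]]. Qed.
Let sub_UD : U `<=` D. Proof. by case: can_t => -[[[]]]. Qed.
Let smooth_s : smooth U s. Proof. by case: can_s => -[[_ []]]. Qed.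
Let smooth_phis : smooth (s @` U) phis. Proof. by case: can_s => -[[_ []]]. Qed.
Let phisK p : U p -> phis (s p) = p.
Proof. by case: can_s => -[[_ []]] + *; apply. Qed.
Let open_sU : open (s @` U). Proof. by case: can_s => -[[[]]]. Qed.

Let phis_U q : (s @` U) q -> U (phis q).
Proof. by move=> [p Up <-]; rewrite phisK. Qed.

Let phit_U q : (t @` U) q -> U (phit q).
Proof. by move=> [p Up <-]; rewrite phitK. Qed.

Let T_tU q : (s @` U) q -> (t @` U) (T q).
Proof. by move=> /phis_U Uq; exists (phis q). Qed.

Let d2x := smooth_twice_differentiable (smooth_subset sub_UD smooth_x).

Let d2T : twice_differentiable (s @` U) T.
Proof.
apply: twice_differentiable_comp phis_U _ _ => //;
  exact: smooth_twice_differentiable.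
Qed.

Let d2y : twice_differentiable (t @` U) (x \o phit).
Proof.
apply: (twice_differentiable_comp open_tU phit_U _ d2x).
exact: smooth_twice_differentiable.
Qed.

Let d2z : twice_differentiable (s @` U) (x \o phis).
Proof.
apply: (twice_differentiable_comp open_sU phis_U _ d2x).
exact: smooth_twice_differentiable.
Qed.

Let zE q : (s @` U) q -> (x \o phis) q = ((x \o phit) \o T) q.
Proof. by move=> [p Up <-]; rewrite /T /= phisK // phitK. Qed.

Let dT q : (s @` U) q ->
  [/\ (partial_u T q).1 ^+ 2 = 1, partial_u T q = ((partial_u T q).1, 0) &
      partial_v T q = (0, e * (partial_u T q).1)].
Proof.
move=> sUq; have [isot cant] := can_t; have [isos cans] := can_s.
have [E F Eneg] := isot.2 _ (T_tU sUq).
(* The conformal factor [l] is [coefG], positive because [coefE] is its negative and is below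
   zero. *)
apply: (canonical_change open_sU open_tU T_tU d2T d2y d2z zE sUq
  (l := coefG (x \o phit) (T q))) (isos.2 _ sUq) (cant _ (T_tU sUq))
  (cans _ sUq) _ sqr_e (jac sUq).
by split=> //; rewrite -oppr_lt0 -E.
Qed.

Let continuous_s p : U p -> {for p, continuous s}.
Proof. by move: p; exact: (smooth_s 0). Qed.

(** The entry is a continuous function of the point with square 1, and [U] is connected. *)
Let constant_sign p p' : U p -> U p' ->
  (partial_u T (s p')).1 = (partial_u T (s p)).1.
Proof.
apply: (locally_constant_connected conn_U
  (f := fun p => (partial_u T (s p)).1)) => {p' }p Up.
have sUp : (s @` U) (s p) by exists p.
have cT : {for p, continuous (fun p => (partial_u T (s p)).1)}.
  apply: (@continuous_comp _ _ _ s (fun q => (partial_u T q).1)).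
    exact: continuous_s.
  apply: differentiable_continuous; apply: differentiable_fst.
  exact: d2T.2.
have /cvgr_distC_lt/(_ _ ltr01) := cT.
apply: filterS => p' /= lt1 Up'.
have sUp' : (s @` U) (s p') by exists p'.
have [a2 _ _] := dT sUp; have [b2 _ _] := dT sUp'.
exact: sign_eq b2 a2 lt1.
Qed.

Lemma transition_affine : U !=set0 -> exists a c,
  a ^+ 2 = 1 /\ forall p, U p -> t p = dscale a (e * a) (s p) + c.
Proof.
move=> [p0 Up0]; have sUp0 : (s @` U) (s p0) by exists p0.
pose a := (partial_u T (s p0)).1.
exists a, (T (s p0) - dscale a (e * a) (s p0)); split; first by case: (dT sUp0).
(* The difference of [T] and its expected linear part has zero derivative, hence keeps its value at
   [s p0], which was chosen as the constant. *)
move=> p Up; have /= <- // : (T \- dscale a (e * a)) (s p) =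
                             (T \- dscale a (e * a)) (s p0).
  apply: (derive0_constant conn_U open_sU continuous_s) => // q [p' Up' <-].
  have sUp' : (s @` U) (s p') by exists p'.
  have [_ Tu Tv] := dT sUp'; have dTq := d2T.1 _ sUp'.
  have dq := differentiable_dscale a (e * a) (s p').
  split=> [|w]; first exact: differentiableB.
  rewrite deriveB; [|exact: diff_derivable..].
  rewrite derive_dscale (derive_plane _ dTq) Tu Tv (constant_sign Up0 Up') -/a.
  apply/eqP; rewrite subr_eq0; apply/eqP; rewrite /dscale.
  rewrite -[LHS]/(w.1 * a + w.2 * 0, w.1 * 0 + w.2 * (e * a)).
  by congr (_, _); rewrite mulr0 ?addr0 ?add0r mulrC.
by rewrite addrC subrK /T /= phisK.
Qed.

End Transition.

(** * The two orientation cases, with [e] equal to 1 and to -1 *)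

Theorem theorem6p8 (R : realType) (n : nat) (n_ge3 : (3 <= n)%N)
    (D : set (dnum R)) (x : dnum R -> 'rV[R]_n)
    (surf : timelike_surface D x) (min_x : minimal_surface D x)
    (gen_x : general_type D x)
    (p0 : dnum R) (D_p0 : D p0)
    (U : set (dnum R)) (U_p0 : U p0) (conn_U : connected U)
    (t phit s phis : dnum R -> dnum R)
    (can_t : canonical_coordinates D x U t phit)
    (can_s : canonical_coordinates D x U s phis) :
  (same_orientation U t s phis ->
     exists c : dnum R,
       (forall p, U p -> t p = s p + c) \/
       (forall p, U p -> t p = - s p + c)) /\
  (opposite_orientation U t s phis ->
     exists c : dnum R,
       (forall p, U p -> t p = dconj (s p) + c) \/
       (forall p, U p -> t p = - dconj (s p) + c)).
Proof.
have [_ [smooth_x _ _]] := surf; have U0 : U !=set0 by exists p0.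
have dscaleN (k1 k2 : R) q : dscale (- k1) (- k2) q = - dscale k1 k2 q.
  by rewrite /dscale !scaleNr.
have dscale11 (q : dnum R) : dscale 1 1 q = q.
  by rewrite /dscale !scale1r -surjective_pairing.
have dscale1N (q : dnum R) : dscale 1 (-1) q = dconj q.
  by rewrite /dscale scale1r scaleN1r.
split=> orient.
  have jac q : (s @` U) q -> 0 < 1 * jacobian_det (t \o phis) q.
    by rewrite mul1r; exact: orient.
  have [a [c [/eqP a2 tE]]] := transition_affine smooth_x conn_U can_t can_s
    (expr1n _ _) jac U0.
  exists c; move: a2 tE; rewrite sqrf_eq1 => /orP[]/eqP-> tE.
    by left=> p /tE; rewrite mulr1 dscale11.
  by right=> p /tE; rewrite mul1r dscaleN dscale11.
have jac q : (s @` U) q -> 0 < -1 * jacobian_det (t \o phis) q.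
  by rewrite mulN1r oppr_gt0; exact: orient.
have [a [c [/eqP a2 tE]]] := transition_affine smooth_x conn_U can_t can_s
  (sqrr_sign _ 1) jac U0.
exists c; move: a2 tE; rewrite sqrf_eq1 => /orP[]/eqP-> tE.
  by left=> p /tE; rewrite mulr1 dscale1N.
right=> p /tE; rewrite mulN1r opprK => ->.
(* The factors -1 and 1 are the opposites of 1 and -1, which represent the conjugation. *)
by rewrite -[X in dscale _ X](opprK 1) dscaleN dscale1N.
Qed.
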